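(* Let $p$ be an odd prime and let $\mathcal{R}_p=\{x^2: x\in\mathbb{F}_p^\times\}$ be the set of (nonzero) quadratic residues in $\mathbb{F}_p$. Assume that $\mathcal{A},\mathcal{B}\subseteq\mathbb{F}_p$ satisfy $|\mathcal{A}|,|\mathcal{B}|\geqslant 2$ and $\mathcal{A}+\mathcal{B}=\mathcal{R}_p$, where $\mathcal{A}+\mathcal{B}=\{a+b:a\in\mathcal{A},b\in\mathcal{B}\}$. Then \[\frac{1}{4}\sqrt{p}+\frac18\leqslant |\mathcal{A}|,|\mathcal{B}|< 2\sqrt{p}-1.\]
   Context: $\mathbb{F}_p$ is the finite field with $p$ elements; $\mathcal{R}_p$ has $(p-1)/2$ elements. *)

(* Defs.v *)
From HB Require Import structures.
From mathcomp Require Import all_boot all_order all_algebra.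

Set Implicit Arguments.
Unset Strict Implicit.
Unset Printing Implicit Defensive.

Import Order.TTheory GRing.Theory Num.Theory.
Local Open Scope ring_scope.

Definition sumset (G : finZmodType) (A B : {set G}) : {set G} :=
  [set a + b | a in A, b in B].

(* The nonzero quadratic residues. 'F_p is the field with p elements only for
   p prime. *)
Definition quadres (p : nat) : {set 'F_p} :=
  [set x ^+ 2 | x : 'F_p & x != 0].

(* Main.v *)
(* Let q = #|F|, chi the quadratic character, n = #|B| and S(x) = sum_(b in B) chi(x + b),
   so that S = n on A and #|A| n >= (q - 1) / 2. Summing S^2 (S + 2)^2 over F gives

     #|A| n^2 (n + 2)^2 <= (2 sqrt q - 1) (n)_4 + 8 sqrt q (n)_3 + O(q n^2),

   with explicit lower-order terms, where (n)_k is the falling factorial. The input is the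
   bound 2 sqrt q for sums of chi over a cubic with three distinct roots, and its consequence
   2 sqrt q - 1 for a quartic with four distinct roots (move one root to infinity). Elementary
   algebra concludes for n >= 3. For n = 2 and q large, three residues
   x + b, x + c, x + c + (c - b) are found, so that x + c has two representations, whereas
   only (q - 1) / 4 elements y or fewer have y + b and y + c both residues.

   The cubic bound is Hasse's theorem, proved after Manin. For f = X (X^2 + a X + b), let P_k
   be the points (X^q, f^((q-1)/2)) + k (X, 1) of the curve f y^2 = f(x) over F(X). The
   abscissas of P_(k-1) and P_(k+1) are the roots of a quadratic polynomial whose coefficients
   depend only on the abscissa of P_k, and the resulting relation between the three is
   symmetric. The sequence of abscissas U_k / V_k is thus obtained by Vieta jumping, without
   the group law, and deg U_k = k^2 - s k + q where s = sum_c chi(f(c)). This is nonnegative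
   for all k, hence s^2 <= 4 q. *)
Require Import Defs.
From HB Require Import structures.
From mathcomp Require Import all_boot all_order all_algebra.
From mathcomp Require Import all_fingroup all_solvable all_field.
From mathcomp Require Import ring lra zify.

Set Implicit Arguments.
Unset Strict Implicit.
Unset Printing Implicit Defensive.

Import Order.TTheory GRing.Theory Num.Theory.
Local Open Scope ring_scope.

(** * Vieta jumping *)

Section VietaJumping.

Variables (F : fieldType) (a b : F).
Hypotheses (two_neq0 : 2 != 0 :> F) (b_neq0 : b != 0) (disc_neq0 : a ^+ 2 - 4 * b != 0).
Implicit Types U V : {poly F}.

(* When [U / V] is the abscissa of a point [P] of the curve [f y^2 = f(x)], the abscissas
   of the points [P + ('X, 1)] and [P - ('X, 1)] are the roots [z] of
   [qC U V * z ^+ 2 - qB U V * z + qA U V]. *)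
Definition qA U V := ('X * U - b%:P * V) ^+ 2.
Definition qB U V :=
  2 * ((U + 'X * V) * ('X * U + b%:P * V) + 2 * a%:P * 'X * U * V).
Definition qC U V := (U - 'X * V) ^+ 2.

(** Vieta's formulas for the two roots [U' / V'] and [U'' / V'']. They are exact, not up to a common
    factor, so that degrees can be read off and lowest terms are inherited. *)
Definition neighbours U' V' U V U'' V'' :=
  [/\ U' * U'' = qA U V, V' * V'' = qC U V & U' * V'' + U'' * V' = qB U V].

(** This replaces the passage to an irreducible factor of [g], which would divide [e] as soon as it
    divides [e ^+ 2]. *)
Lemma dvdp_sqr_coprime (g e : {poly F}) :
  g %| e ^+ 2 -> (forall h, h %| g -> h %| e -> h %| 1) -> g %| 1.
Proof.
move=> ge2 H.
have cop : coprimep g e.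
  by apply/coprimepP => h hg he; rewrite -size_poly_eq1 -dvdp1; apply: H.
have : coprimep g (e ^+ 2) by rewrite coprimep_expr.
by move/coprimepP => /(_ g (dvdpp _) ge2); rewrite dvdp1 size_poly_eq1.
Qed.

(** A common divisor [h] of ['X * U - b%:P * V] and [U - 'X * V] is prime to [V], hence divides
    ['X ^+ 2 - b%:P]. Modulo these, [qB U V] is [4 b (2 X + a) V^2], so [h] divides [2 X + a], and
    then the nonzero constant [a ^+ 2 - 4 * b]. *)
Lemma common_dvdp_q U V (g : {poly F}) : coprimep U V ->
  g %| qA U V -> g %| qB U V -> g %| qC U V -> g %| 1.
Proof.
move=> copUV gA gB gC.
apply: (dvdp_sqr_coprime gA) => k kg kA.
have kC := dvdp_trans kg gC.
apply: (dvdp_sqr_coprime kC) => h hk hC.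
have hA := dvdp_trans hk kA.
have hB := dvdp_trans (dvdp_trans hk kg) gB.
have copV : coprimep h V.
  apply/coprimepP => d dh dV.
  have dU : d %| U.
    have -> : U = (U - 'X * V) + 'X * V by ring.
    by rewrite dvdp_add ?dvdp_mull //; exact: dvdp_trans dh hC.
  by move/coprimepP: copUV => /(_ d dU dV).
have h1 : h %| 'X ^+ 2 - b%:P.
  rewrite -(Gauss_dvdpl _ copV).
  have -> : ('X ^+ 2 - b%:P) * V =
     ('X * U - b%:P * V) - 'X * (U - 'X * V) by ring.
  by rewrite dvdp_sub // dvdp_mull.
have h2 : h %| 2 * 'X + a%:P.
  have copV2 : coprimep h (V ^+ 2) by rewrite coprimep_expr.
  have : h %| (4 * b%:P) * ((2 * 'X + a%:P) * V ^+ 2).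
    have -> : (4 * b%:P) * ((2 * 'X + a%:P) * V ^+ 2) = qB U V
       - 2 * ((U - 'X * V) * ('X * U + b%:P * V) + 2 * 'X * V * ('X * (U - 'X * V))
             + 2 * a%:P * 'X * V * (U - 'X * V))
       - ('X ^+ 2 - b%:P) * (4 * (a%:P + 'X) * V ^+ 2).
      by rewrite /qB; ring.
    apply: dvdp_sub; last exact: dvdp_mulr h1.
    apply: dvdp_sub => //; apply: dvdp_mull.
    apply: dvdp_add; last exact: dvdp_mull.
    apply: dvdp_add; first exact: dvdp_mulr.
    by apply: dvdp_mull; apply: dvdp_mull.
  have -> : 4 * b%:P = (4 * b)%:P by rewrite polyCM -polyC_natr.
  rewrite mul_polyC dvdpZr ?Gauss_dvdpl //.
  have -> : 4 = 2 * 2 :> F by ring.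
  by rewrite !mulf_neq0.
have : h %| (a ^+ 2 - 4 * b)%:P.
  have -> : (a ^+ 2 - 4 * b)%:P = 4 * ('X ^+ 2 - b%:P)
       - (2 * 'X - a%:P) * (2 * 'X + a%:P).
    by rewrite polyCB polyC_exp polyCM -polyC_natr; ring.
  by rewrite dvdp_sub // dvdp_mull.
by rewrite -[_%:P]mulr1 mul_polyC dvdpZr.
Qed.

Lemma neighbours_coprime U' V' U V U'' V'' : coprimep U V ->
  neighbours U' V' U V U'' V'' -> coprimep U'' V''.
Proof.
move=> copUV [eA eC eB]; apply/coprimepP => g gU gV; rewrite -size_poly_eq1 -dvdp1.
apply: (common_dvdp_q copUV).
- by rewrite -eA dvdp_mull.
- by rewrite -eB; apply: dvdp_add; [exact: dvdp_mull | exact: dvdp_mulr].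
- by rewrite -eC dvdp_mull.
Qed.

(* [size] at one fixed inheritance path from fields to semirings, so that [lia] sees
   convertible sizes as equal atoms. *)
Definition psize (p : {poly F}) : nat := size p.

Lemma psize_gt0 p : (0 < psize p)%N = (p != 0).
Proof. exact: size_poly_gt0. Qed.

Lemma psizeM p q : p != 0 -> q != 0 -> psize (p * q) = (psize p + psize q).-1.
Proof. exact: size_mul. Qed.

Lemma psizeM_leq p q : (psize (p * q) <= (psize p + psize q).-1)%N.
Proof. exact: size_polyMleq. Qed.

Lemma psizeX p : p != 0 -> psize ('X * p) = (psize p).+1.
Proof. by rewrite mulrC; exact: size_mulX. Qed.

Lemma psizeX_leq p : (psize ('X * p) <= (psize p).+1)%N.
Proof.
have [->|p0] := eqVneq p 0; last by rewrite psizeX.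
by rewrite mulr0 /psize size_poly0.
Qed.

Lemma psizeZ_leq c p : (psize (c%:P * p) <= psize p)%N.
Proof. by rewrite mul_polyC; exact: size_scale_leq. Qed.

Lemma psizeD_leq p q n : (psize p <= n)%N -> (psize q <= n)%N -> (psize (p + q) <= n)%N.
Proof.
by move=> pn qn; apply: leq_trans (size_polyD p q) _; rewrite geq_max; apply/andP.
Qed.

Lemma psizeDl p q : (psize q < psize p)%N -> psize (p + q) = psize p.
Proof. exact: size_polyDl. Qed.

Lemma psizeN p : psize (- p) = psize p.
Proof. exact: size_polyN. Qed.

Lemma psize_qA U V : (psize V < psize U)%N -> psize (qA U V) = (2 * psize U).+1%N.
Proof.
move=> VU; have U0 : U != 0 by rewrite -psize_gt0; lia.
have sXU := psizeX U0; have sbV := psizeZ_leq b V.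
have s1 : psize ('X * U - b%:P * V) = (psize U).+1.
  by rewrite psizeDl sXU // psizeN; lia.
have nz : 'X * U - b%:P * V != 0 by rewrite -psize_gt0 s1.
by rewrite /qA expr2 psizeM // s1; lia.
Qed.

Lemma psize_qB U V : (psize V < psize U)%N -> (psize (qB U V) <= 2 * psize U)%N.
Proof.
move=> VU; have U0 : U != 0 by rewrite -psize_gt0; lia.
have sXV := psizeX_leq V; have sXU := psizeX U0; have sbV := psizeZ_leq b V.
have -> : qB U V = 2%:P * ((U + 'X * V) * ('X * U + b%:P * V) + (2 * a)%:P * ('X * V * U)).
  by rewrite /qB !polyCM -!polyC_natr; ring.
apply: leq_trans (psizeZ_leq _ _) _; apply: psizeD_leq.
  apply: leq_trans (psizeM_leq _ _) _.
  have l1 : (psize (U + 'X * V)%R <= psize U)%N by apply: psizeD_leq; lia.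
  have l2 : (psize ('X * U + b%:P * V)%R <= (psize U).+1)%N by apply: psizeD_leq; lia.
  by lia.
apply: leq_trans (psizeZ_leq _ _) _; apply: leq_trans (psizeM_leq _ _) _.
by lia.
Qed.

(* If [psize V'' >= psize U''], then [U' * V''] has degree at least that of
   [qA U V = U' * U''] and dominates the other summand of [qB U V], which is
   then too large. *)
Lemma neighbours_psize U' V' U V U'' V'' :
  (psize V' < psize U')%N -> (psize V < psize U)%N ->
  neighbours U' V' U V U'' V'' ->
  (psize U' + psize U'' = 2 * psize U + 2)%N /\ (psize V'' < psize U'')%N.
Proof.
move=> VU' VU [eA eC eB].
have sA := psize_qA VU; have sB := psize_qB VU.
have nz : U' * U'' != 0 by rewrite eA -psize_gt0 sA.
have [U'0 U''0] : U' != 0 /\ U'' != 0 by apply/andP; rewrite -negb_or -mulf_eq0.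
have p' : (0 < psize U')%N by rewrite psize_gt0.
have p'' : (0 < psize U'')%N by rewrite psize_gt0.
have sz : (psize U' + psize U'' = 2 * psize U + 2)%N.
  by have := congr1 psize eA; rewrite psizeM // sA; lia.
split=> //; rewrite ltnNge; apply/negP => le.
have V''0 : V'' != 0 by rewrite -psize_gt0; lia.
have s1 := psizeM U'0 V''0; have s2 := psizeM_leq U'' V'.
by move: sB; rewrite -eB psizeDl s1; lia.
Qed.

(** The biquadratic relation between consecutive abscissas is symmetric ([rel]), so [U' / V'] is a
    root of the quadratic attached to [U'' / V'']. Coprimality makes the other root a pair of exact
    quotients. *)
Lemma neighbours_step U V U' V' U'' V'' : coprimep U' V' -> (psize V' < psize U')%N ->
  neighbours U V U' V' U'' V'' ->
  exists W Z, neighbours U' V' U'' V'' W Z.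
Proof.
move=> copUV' VU' [eA eC eB].
have U'0 : U' != 0 by rewrite -psize_gt0; lia.
have rel : qC U'' V'' * U' ^+ 2 - qB U'' V'' * (U' * V') + qA U'' V'' * V' ^+ 2 = 0.
  have -> : qC U'' V'' * U' ^+ 2 - qB U'' V'' * (U' * V') + qA U'' V'' * V' ^+ 2
    = qC U' V' * U'' ^+ 2 - qB U' V' * (U'' * V'') + qA U' V' * V'' ^+ 2.
    by rewrite /qA /qB /qC; ring.
  by rewrite -eA -eC -eB; ring.
have UA : U' %| qA U'' V''.
  rewrite -(Gauss_dvdpl _ (coprimep_expr 2 copUV')).
  have -> : qA U'' V'' * V' ^+ 2 = U' * (qB U'' V'' * V' - qC U'' V'' * U').
    by apply/eqP; rewrite -subr_eq0 -rel; apply/eqP; ring.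
  exact: dvdp_mulr (dvdpp _).
have VC : V' %| qC U'' V''.
  rewrite coprimep_sym in copUV'; rewrite -(Gauss_dvdpl _ (coprimep_expr 2 copUV')).
  have -> : qC U'' V'' * U' ^+ 2 = V' * (qB U'' V'' * U' - qA U'' V'' * V').
    by apply/eqP; rewrite -subr_eq0 -rel; apply/eqP; ring.
  exact: dvdp_mulr (dvdpp _).
(* If [V'] is 0 (point at infinity), then [U'] is a constant and [rel] gives [qC U'' V'' = 0]; the
   new denominator must come from the equation for [qB]. *)
have [V'0|V'0] := eqVneq V' 0.
  have U1 : size U' == 1%N by move: copUV'; rewrite V'0 coprimep0 -size_poly_eq1.
  have UB : U' %| qB U'' V''.
    by move: U1; rewrite size_poly_eq1 => /eqp_dvdl ->; rewrite dvd1p.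
  exists (qA U'' V'' %/ U'), (qB U'' V'' %/ U'); split.
  - by rewrite mulrC divpK.
  - move: rel; rewrite V'0 expr0n !mulr0 mul0r subr0 addr0 => /eqP.
    by rewrite mulf_eq0 [U' ^+ 2 == 0]expf_eq0 (negPf U'0) orbF => /eqP ->.
  - by rewrite V'0 mulr0 addr0 mulrC divpK.
have eqA : U' * (qA U'' V'' %/ U') = qA U'' V'' by rewrite mulrC divpK.
have eqC : V' * (qC U'' V'' %/ V') = qC U'' V'' by rewrite mulrC divpK.
exists (qA U'' V'' %/ U'), (qC U'' V'' %/ V'); split=> //.
(* After multiplication by [U' * V'], the remaining equation is [rel]. *)
apply: (mulfI (mulf_neq0 U'0 V'0)).
apply/eqP; rewrite -subr_eq0 -[0]rel -{2}eqC -{2}eqA; apply/eqP; ring.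
Qed.

(* The second difference of the degrees along the sequence is constantly 2. *)
Lemma neighbours_degree U' V' U V U'' V'' (d0 d1 : int) (n : nat) :
  coprimep U' V' -> coprimep U V -> (psize V' < psize U')%N -> (psize V < psize U)%N ->
  neighbours U' V' U V U'' V'' ->
  (psize U)%:Z = d0 + 1 -> (psize U'')%:Z = d1 + 1 ->
  0 <= n%:Z ^+ 2 + (d1 - d0 - 1) * n%:Z + d0.
Proof.
move=> copUV' copUV VU' VU nb sU sU''.
(* The quadratic with second difference 2 and values [d0], [d1] at 0, 1. It is nonnegative because
   it is the degree of a nonzero numerator. *)
pose d (k : nat) : int := k%:Z ^+ 2 + (d1 - d0 - 1) * k%:Z + d0.
suff: exists W' Z' W Z W'' Z'', [/\ neighbours W' Z' W Z W'' Z'',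
    coprimep W' Z' /\ coprimep W Z, (psize Z' < psize W')%N /\ (psize Z < psize W)%N,
    (psize W)%:Z = d n + 1 & (psize W'')%:Z = d n.+1 + 1].
  by case=> W' [Z' [W [Z [W'' [Z'' [_ _ [_ ZW] sW _]]]]]]; rewrite /d in sW; lia.
elim: n => [|n [W' [Z' [W [Z [W'' [Z'' [nbW [cop' cop] [sz' sz] sW sW'']]]]]]]].
  exists U', V', U, V, U'', V''; split=> //; rewrite /d; lia.
have cop'' := neighbours_coprime cop nbW.
have [dW sz''] := neighbours_psize sz' sz nbW.
have [X [Y nbX]] := neighbours_step cop sz nbW.
have [dX _] := neighbours_psize sz sz'' nbX.
exists W, Z, W'', Z'', X, Y; split=> //.
suff : (psize X)%:Z = 2 * (psize W'')%:Z + 2 - (psize W)%:Z by rewrite /d in sW sW'' *; nia.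
lia.
Qed.

End VietaJumping.

(** Evaluate at the integer [k] nearest to the vertex. For [s = - (2 k + 1)] this gives only
    [k (k + 1) <= q], which falls short by 1; since [k (k + 1)] is even and [q] odd, the inequality
    is strict. *)
Lemma discriminant_le (q : nat) (s : int) : odd q ->
  (forall n : nat, 0 <= n%:Z ^+ 2 + s * n%:Z + q%:Z) ->
  (forall n : nat, 0 <= n%:Z ^+ 2 - s * n%:Z + q%:Z) -> s ^+ 2 <= 4 * q%:Z.
Proof.
move=> q_odd.
wlog : s / s <= 0 => [hw h1 h2|s0 h1 _].
  have [s0|s0] := lerP s 0; first exact: hw.
  rewrite -sqrrN; apply: hw => [|n|n]; [lia | by rewrite mulNr | by rewrite mulNr opprK].
pose k := (`|s|./2)%N.
have := h1 k; have := h1 k.+1; have eo := odd_double_half q; rewrite q_odd /= in eo.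
have es := odd_double_half `|s|%N; rewrite -/k in es.
case: (odd _) es => /= es.
  have ek : s = - (2 * k%:Z) - 1 by lia.
  have et := odd_double_half (k * k.+1)%N; rewrite oddM /= andbN /= in et.
  rewrite ek -mul2n in et * => _; set t := _./2 in et; nia.
have ek : s = - (2 * k%:Z) by lia.
by rewrite ek; nia.
Qed.

(** * The quadratic character of a finite field *)

Section QuadraticCharacter.

Variable F : finFieldType.
Hypothesis F_odd : odd #|F|.
Implicit Types x y : F.

(** Euler's criterion taken as definition, with integer values so that sums live in characteristic
    0. *)
Definition qchar x : int := if x == 0 then 0 else if x ^+ #|F|./2 == 1 then 1 else -1.

Lemma card_odd_half : #|F| = (#|F|./2.*2).+1.
Proof. by rewrite -[LHS]odd_double_half F_odd. Qed.

Lemma half_card_gt0 : (0 < #|F|./2)%N.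
Proof. by have := finNzRing_gt1 F; rewrite card_odd_half; lia. Qed.

Lemma natr_card : #|F|%:R = 0 :> F.
Proof.
by rewrite -FinRing.zmodXgE -cardsT expg_cardG ?inE.
Qed.

Lemma two_neq0 : 2 != 0 :> F.
Proof.
apply/eqP => t0; have := natr_card; rewrite card_odd_half -addn1 natrD -muln2 natrM t0.
by rewrite mulr0 add0r => /eqP; rewrite oner_eq0.
Qed.

Lemma expf_half x : x != 0 -> (x ^+ #|F|./2 == 1) || (x ^+ #|F|./2 == -1).
Proof.
move=> x0; rewrite -eqf_sqr expr1n -exprM muln2.
apply/eqP/(mulfI x0); rewrite mulr1 -exprS -card_odd_half; exact: expf_card.
Qed.

Lemma qcharE x : (qchar x)%:~R = x ^+ #|F|./2.
Proof.
rewrite /qchar; have [->|x0] := eqVneq x 0.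
  by rewrite expr0n -[_ == 0%N]negbK -lt0n half_card_gt0.
by have /orP[/eqP ->|/eqP ->] := expf_half x0; case: eqP => // /eqP.
Qed.

(** Identities between values of [qchar] can thus be checked in [F], where [qchar] is a power
    map. *)
Lemma intr_inj_small (i j : int) : `|i| <= 1 -> `|j| <= 1 -> i%:~R = j%:~R :> F -> i = j.
Proof.
have t0 := two_neq0; have o0 := oner_neq0 F.
have n11 : (-1 == 1 :> F) = false.
  by apply/negbTE; rewrite eq_sym -subr_eq0 opprK -mulr2n.
have n0 : (-1 == 0 :> F) = false by rewrite oppr_eq0 oner_eq0.
have H (k : int) : `|k| <= 1 -> [\/ k = 0, k = 1 | k = -1].
  move=> hk; have [->|k0] := eqVneq k 0; first by constructor 1.
  have [->|k1] := eqVneq k 1; first by constructor 2.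
  by constructor 3; lia.
by move=> /H[]-> /H[]-> //; rewrite ?mulrNz ?mulr1z ?mulr0z => /eqP;
  rewrite ?n11 ?n0 ?(negPf o0) // eq_sym ?n11 ?n0 ?(negPf o0).
Qed.

Lemma qchar_bound x : `|qchar x| <= 1.
Proof. by rewrite /qchar; case: ifP => // _; case: ifP. Qed.

Lemma qcharM x y : qchar (x * y) = qchar x * qchar y.
Proof.
apply: intr_inj_small; rewrite ?qchar_bound //; last by rewrite rmorphM /= !qcharE exprMn.
by rewrite normrM mulr_ile1 // qchar_bound.
Qed.

Lemma qchar0 : qchar 0 = 0. Proof. by rewrite /qchar eqxx. Qed.

Lemma qchar1 : qchar 1 = 1. Proof. by rewrite /qchar oner_eq0 expr1n eqxx. Qed.

Lemma qchar_eq0 x : (qchar x == 0) = (x == 0).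
Proof. by rewrite /qchar; case: (x == 0) => //; case: ifP. Qed.

Lemma qchar_sqr x : x != 0 -> qchar x ^+ 2 = 1.
Proof. by rewrite /qchar => /negPf ->; case: ifP. Qed.

Lemma qchar_square x : x != 0 -> qchar (x ^+ 2) = 1.
Proof. by move=> x0; rewrite expr2 qcharM -expr2 qchar_sqr. Qed.

Lemma card_squares_ge : (#|F|./2 <= #|[set x ^+ 2 | x : F & x != 0%R]|)%N.
Proof.
pose s := [set x : F | x != 0].
have cs : #|s| = (#|F|./2.*2)%N.
  have -> : s = [set~ 0] by apply/setP => x; rewrite !inE.
  by rewrite cardsC1 [#|F| in LHS]card_odd_half.
rewrite -leq_double -cs -sum1_card.
rewrite (partition_big (fun x => x ^+ 2) (mem [set x ^+ 2 | x : F & x != 0])) /=; last first.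
  by move=> x; rewrite inE => x0; apply: imset_f; rewrite inE.
rewrite -muln2 -sum_nat_const; apply: leq_sum => _ /imsetP[z _ ->].
rewrite sum1_card; apply: (@leq_trans #|[set z; - z]|).
  by apply/subset_leq_card/subsetP => x /andP[_]; rewrite !inE eqf_sqr.
by rewrite cards2; case: eqP.
Qed.

Lemma card_qchar1_le : (#|[set x | qchar x == 1%R]| <= #|F|./2)%N.
Proof.
have h := half_card_gt0; pose q : {poly F} := 'X^(#|F|./2) - 1%:P.
have sq : size q = (#|F|./2).+1 by rewrite size_XnsubC.
have q0 : q != 0 by rewrite -size_poly_gt0 sq.
rewrite cardE -ltnS -sq; apply: max_poly_roots (enum_uniq _) => //.
apply/allP => x; rewrite mem_enum inE => /eqP x1.
by rewrite rootE !hornerE -qcharE x1 subrr.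
Qed.

(** Squaring is at most two-to-one, and [X^h - 1] has at most [h] roots, with [h = #|F|./2]: the two
    counts turn the inclusion into an equality. *)
Lemma squares_qchar : [set x ^+ 2 | x : F & x != 0] = [set x | qchar x == 1].
Proof.
apply/eqP; rewrite eqEcard; apply/andP; split.
  by apply/subsetP => _ /imsetP[x x0 ->]; rewrite !inE in x0 *; rewrite qchar_square.
exact: leq_trans card_qchar1_le card_squares_ge.
Qed.

Lemma nonsquare_exists : exists x, qchar x = -1.
Proof.
suff: [exists x, (x != 0) && (qchar x != 1)].
  case/existsP => x /andP[/negPf x0]; rewrite /qchar x0.
  by case: ifP => // e _; exists x; rewrite x0 e.
apply: contraTT (ltnSn #|F|./2) => /existsPn H; rewrite -leqNgt.
have c0 : #|[set x : F | x != 0]| = (#|F|./2.*2)%N.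
  have -> : [set x : F | x != 0] = [set~ 0] by apply/setP => x; rewrite !inE.
  by rewrite cardsC1 [#|F| in LHS]card_odd_half.
have h := half_card_gt0; apply: leq_trans card_qchar1_le.
apply: (@leq_trans #|[set x : F | x != 0]|); first by rewrite c0; lia.
apply/subset_leq_card/subsetP => x; rewrite !inE => x0.
by have := H x; rewrite x0 /= negbK.
Qed.

Lemma sum_qchar : \sum_x qchar x = 0.
Proof.
have [n qn] := nonsquare_exists.
have n0 : n != 0 by rewrite -qchar_eq0 qn.
have : \sum_x qchar x = - \sum_x qchar x.
  rewrite [LHS](reindex_inj (mulfI n0)) -sumrN; apply: eq_bigr => x _.
  by rewrite qcharM qn mulN1r.
lia.
Qed.

Lemma sum_translate (V : nmodType) (g : F -> V) c : \sum_x g (x + c) = \sum_x g x.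
Proof. by rewrite [RHS](reindex_inj (addIr c)). Qed.

Lemma sum_qchar_affine (u v : F) : u != 0 -> \sum_x qchar (u * x + v) = 0.
Proof.
move=> u0; rewrite -[RHS]sum_qchar -[RHS](sum_translate qchar v).
by rewrite [RHS](reindex_inj (mulfI u0)).
Qed.

Lemma qchar_inv_add (y c : F) : y != 0 -> qchar (y^-1 + c) = qchar y * qchar (c * y + 1).
Proof.
move=> y0; have -> : y^-1 + c = y * (c * y + 1) * y^-1 ^+ 2 by field.
by rewrite !qcharM -expr2 qchar_sqr ?invr_eq0 // mulr1.
Qed.

Lemma qchar_affine (c y : F) : c != 0 -> qchar (c * y + 1) = qchar c * qchar (y + c^-1).
Proof. by move=> c0; rewrite -qcharM mulrDr divff. Qed.

(** After a translation, the substitution of [x^-1] for [x] leaves a sum over an affine function,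
    which vanishes, minus its term 1 at 0. *)
Lemma sum_qchar_pair (b c : F) : b != c -> \sum_x qchar (x + b) * qchar (x + c) = -1.
Proof.
move=> bc; rewrite -(sum_translate _ (- b)) (reindex_inj invr_inj) /=.
have cb : c - b != 0 by rewrite subr_eq0 eq_sym.
rewrite (bigD1 0) //= invr0 !add0r addNr qchar0 mul0r add0r.
have := sum_qchar_affine 1 cb; rewrite (bigD1 0) //= mulr0 add0r qchar1 => /eqP.
rewrite addrC addr_eq0 => /eqP <-; apply: eq_bigr => y y0.
rewrite addrNK -addrA [- b + c]addrC qchar_inv_add // -[y^-1]addr0 qchar_inv_add //.
by rewrite mul0r add0r qchar1 mulr1 mulrA -expr2 qchar_sqr // mul1r.
Qed.

(* Substituting [x^-1] for [x] makes a quartic with a rational root a cubic. *)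
Lemma sum_qchar_invert (c1 c2 c3 : F) : c1 != 0 -> c2 != 0 -> c3 != 0 ->
  \sum_x qchar x * qchar (x + c1) * qchar (x + c2) * qchar (x + c3) =
  qchar c1 * qchar c2 * qchar c3 *
  (\sum_x qchar (x + c1^-1) * qchar (x + c2^-1) * qchar (x + c3^-1)) - 1.
Proof.
move=> n1 n2 n3.
have -> : qchar c1 * qchar c2 * qchar c3 *
    (\sum_x qchar (x + c1^-1) * qchar (x + c2^-1) * qchar (x + c3^-1)) =
    \sum_y qchar (c1 * y + 1) * qchar (c2 * y + 1) * qchar (c3 * y + 1).
  by rewrite big_distrr; apply: eq_bigr => y _; rewrite !qchar_affine //=; ring.
(* As [0^-1 = 0], the term at 0 is 0 on the left; on the right it is 1, which cancels the [- 1]. *)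
rewrite (reindex_inj invr_inj) /= [in RHS](bigD1 0) //= (bigD1 0) //=.
rewrite invr0 !mulr0 !add0r qchar0 qchar1 !mul0r add0r !mulr1 addrAC subrr add0r.
apply: eq_bigr => y y0; rewrite !qchar_inv_add // -{1}[y^-1]addr0 qchar_inv_add //.
rewrite mul0r add0r qchar1 mulr1.
transitivity ((qchar y ^+ 2) ^+ 2 * (qchar (c1 * y + 1) * qchar (c2 * y + 1) * qchar (c3 * y + 1))).
  by ring.
by rewrite qchar_sqr // expr1n mul1r.
Qed.

End QuadraticCharacter.

(** * Hasse's bound *)

Section Hasse.

Variables (F : finFieldType) (a b : F).
Hypotheses (F_odd : odd #|F|) (b_neq0 : b != 0) (disc_neq0 : a ^+ 2 - 4 * b != 0).

Let f : {poly F} := 'X * ('X ^+ 2 + a%:P * 'X + b%:P).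
Let q := #|F|.
Let h := #|F|./2.

Lemma dvdp_prod_exp_XsubC (e : F -> nat) (p : {poly F}) :
  (forall c, ('X - c%:P) ^+ e c %| p) -> \prod_c ('X - c%:P) ^+ e c %| p.
Proof.
move=> H; rewrite -big_enum; have := enum_uniq F.
elim: (enum F) => [|c s IHs] /=; first by rewrite big_nil dvd1p.
case/andP => cs us; rewrite big_cons Gauss_dvdp ?H ?IHs //.
apply: coprimep_expl; rewrite coprimep_sym coprimep_XsubC.
elim: s cs {IHs us} => [|d s IHs]; rewrite ?big_nil ?root1 ?big_cons // inE negb_or.
case/andP => cd cs; rewrite rootM negb_or IHs // andbT.
by rewrite rootE !hornerE expf_eq0 subr_eq0 (negPf cd) andbF.
Qed.

(** Frobenius is additive and fixes the constants. Since [q = 2 h + 1], this says that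
    [('X^q, f ^+ h)] lies on the twisted curve. *)
Lemma exprq_poly : f ^+ q = 'X^q * ('X^q ^+ 2 + a%:P * 'X^q + b%:P).
Proof.
have [p pr_p pcharF] := finPcharP F.
have pq : [pchar {poly F}].-nat q.
  rewrite /q -cardsT (eq_pnat _ (pchar_poly F)) (eq_pnat _ (pcharf_eq pcharF)).
  exact/abelem_pgroup/fin_ring_pchar_abelem.
have polyCq c : c%:P ^+ q = c%:P :> {poly F} by rewrite -polyC_exp expf_card.
by rewrite /f exprMn !exprDn_pchar // !exprMn !polyCq expr2.
Qed.

(** Half of [qB a b 'X^q 1], hence the mean of the two numerators [start_num]. *)
Definition half_sum : {poly F} :=
  ('X^q + 'X) * ('X * 'X^q + b%:P) + 2 * a%:P * 'X * 'X^q.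

(* [start_num sg / ('X^q - 'X) ^+ 2] is the abscissa of the sum of the points
   [('X^q, f ^+ h)] and [('X, +-1)] of the twisted curve [f y^2 = f(x)]. *)
Definition start_num (sg : bool) : {poly F} := half_sum + (2 * (-1) ^+ sg)%:P * f ^+ h.+1.

(** The exponent of ['X - c%:P] left in the denominator after cancellation. The integer inside is 0,
    1 or 2, and the exponents for the two signs add up to 2. *)
Definition start_mult (sg : bool) (c : F) : nat := absz (1 + (-1) ^+ sg * qchar f.[c]).

Definition start_den (sg : bool) : {poly F} := \prod_c ('X - c%:P) ^+ start_mult sg c.

Lemma start_multE sg c : (start_mult sg c)%:Z = 1 + (-1) ^+ sg * qchar f.[c].
Proof.
rewrite /start_mult; have := qchar_bound f.[c].
by case: sg; rewrite ?expr1 ?expr0 ?mulN1r ?mul1r; lia.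
Qed.

Lemma start_numM : start_num true * start_num false = qA b 'X^q 1 * qC 'X^q 1.
Proof.
have -> : start_num true * start_num false = half_sum ^+ 2 - 4 * (f * f ^+ q).
  rewrite /start_num expr1 expr0 -exprS; have -> : q.+1 = (h.+1 * 2)%N.
    by rewrite /q (card_odd_half F_odd) -/h; lia.
  by rewrite exprM mulrN1 polyCN !mulr1 -polyC_natr; ring.
by rewrite exprq_poly /f /half_sum /qA /qC; ring.
Qed.

Lemma start_denM : start_den true * start_den false = qC 'X^q 1.
Proof.
rewrite /qC mulr1 /start_den -big_split finField_genPoly /= -prodrXl.
apply: eq_bigr => c _; rewrite -exprD; congr (_ ^+ _).
by have := start_multE true c; have := start_multE false c; rewrite expr0 expr1; lia.
Qed.

Lemma start_num_horner sg c : (start_num sg).[c] = 2 * f.[c] * (1 + ((-1) ^+ sg * qchar f.[c])%:~R).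
Proof.
rewrite rmorphM rmorphXn /= rmorphN1 (qcharE F_odd) -/h /start_num /half_sum.
have fE : f.[c] = c * (c ^+ 2 + a * c + b) by rewrite /f hornerM !hornerE.
move: fE; move: (f) => g fE; rewrite !hornerE (expf_card c) exprS.
move: (_ ^+ h) => z; rewrite fE; ring.
Qed.

(** At each [c] the required multiplicity is [1 - s]. For [s = 0], [f] and hence the numerator
    vanish at [c]. For [s = -1] the opposite numerator does not vanish at [c], so the double root of
    [('X^q - 'X) ^+ 2], which divides the product of the numerators, belongs to [start_num sg]. *)
Lemma start_den_dvd sg : start_den (~~ sg) %| start_num sg.
Proof.
have n2 := two_neq0 F_odd.
apply: dvdp_prod_exp_XsubC => c.
have /eqP := start_num_horner sg c; set s := (-1) ^+ sg * qchar f.[c] => /eqP numE.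
have := start_multE (~~ sg) c; have /eqP := start_num_horner (~~ sg) c.
have -> : (-1) ^+ (~~ sg) * qchar f.[c] = - s.
  by rewrite /s; case: (sg); rewrite /= ?expr1 ?expr0 ?mulN1r ?mul1r ?opprK.
have s_bound : `|s| <= 1 by rewrite normrM normrX normrN1 expr1n mul1r qchar_bound.
move=> /eqP numE' eK.
have [s0|s0|s0] : [\/ s = 1, s = 0 | s = -1].
- have [->|s1] := eqVneq s 1; first by constructor 1.
  by have [->|s0] := eqVneq s 0; [constructor 2 | constructor 3; lia].
- have -> : start_mult (~~ sg) c = 0%N by lia.
  by rewrite expr0 dvd1p.
- have -> : start_mult (~~ sg) c = 1%N by lia.
  rewrite expr1 dvdp_XsubCl rootE numE s0.
  have /eqP : s = 0 by [].
  rewrite /s mulf_eq0 signr_eq0 /= qchar_eq0 => /eqP ->.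
  by rewrite mulr0 mul0r.
have -> : start_mult (~~ sg) c = 2 by lia.
have fc0 : f.[c] != 0 by apply: contra_eq_neq s0 => fc; rewrite /s fc qchar0 mulr0.
have -> : ('X - c%:P) ^+ 2 %| start_num sg = (('X - c%:P) ^+ 2 %| start_num true * start_num false).
  have cop : coprimep (('X - c%:P) ^+ 2) (start_num (~~ sg)).
    apply: coprimep_expl; rewrite coprimep_sym coprimep_XsubC rootE numE' s0 opprK mulr1z.
    by rewrite !mulf_neq0.
  by clear -cop; case: sg cop => /= cop; [rewrite Gauss_dvdpl | rewrite Gauss_dvdpr].
rewrite start_numM dvdp_mull // /qC mulr1 dvdp_exp2r // dvdp_XsubCl rootE.
by rewrite !hornerE expf_card subrr.
Qed.

Lemma psize_half_sum : psize half_sum = (2 * q).+2%N.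
Proof.
have q2 : (1 < q)%N := finNzRing_gt1 F.
have sXq : psize ('X^q : {poly F}) = q.+1 by exact: size_polyXn.
have sX : psize ('X : {poly F}) = 2%N by exact: size_polyX.
have sb : (psize b%:P <= 1)%N by exact: size_polyC_leq1.
have Xq0 : 'X^q != 0 :> {poly F} by rewrite -psize_gt0 sXq.
have s1 : psize ('X^q + 'X : {poly F}) = q.+1 by rewrite psizeDl sXq // sX.
have s2 : psize ('X * 'X^q + b%:P) = q.+2.
  have s2' : psize ('X * 'X^q : {poly F}) = q.+2 by rewrite psizeX // sXq.
  by rewrite psizeDl s2' //; apply: leq_trans sb _.
have n1 : 'X^q + 'X != 0 :> {poly F} by rewrite -psize_gt0 s1.
have n2 : 'X * 'X^q + b%:P != 0 by rewrite -psize_gt0 s2.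
have s3 : psize (('X^q + 'X) * ('X * 'X^q + b%:P)) = (2 * q).+2%N.
  by rewrite psizeM // s1 s2; lia.
rewrite /half_sum (_ : 2 * a%:P * 'X * 'X^q = (2 * a)%:P * ('X * 'X^q)).
  rewrite psizeDl s3 //; apply: leq_ltn_trans (psizeZ_leq _ _) _.
  by rewrite psizeX // sXq; lia.
by rewrite polyCM -polyC_natr; ring.
Qed.

Lemma psize_f : psize f = 4%N.
Proof.
have s1 : psize ('X ^+ 2 + (a%:P * 'X + b%:P)) = 3%N.
  rewrite psizeDl /psize size_polyXn // ltnS; apply: psizeD_leq.
    by apply: leq_trans (psizeZ_leq _ _) _; rewrite /psize size_polyX.
  by apply: leq_trans (size_polyC_leq1 _) _.
by rewrite /f psizeX -addrA ?s1 // -psize_gt0 s1.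
Qed.

Lemma psize_exp (p : {poly F}) n : p != 0 -> psize (p ^+ n) = ((psize p).-1 * n).+1.
Proof.
move=> p0; have := size_exp p n; rewrite /psize => <-.
by rewrite prednK // size_poly_gt0 expf_neq0.
Qed.

Lemma psize_start_num sg : psize (start_num sg) = (2 * q).+2%N.
Proof.
have q2 : (1 < q)%N := finNzRing_gt1 F.
have f0 : f != 0 by rewrite -psize_gt0 psize_f.
have qh : q = h.*2.+1 := card_odd_half F_odd.
(* The degree [3 (q + 1) / 2] of [f ^+ h.+1] is below the degree [2 q + 1] of [half_sum]. *)
rewrite /start_num psizeDl psize_half_sum //; apply: leq_ltn_trans (psizeZ_leq _ _) _.
by rewrite psize_exp // psize_f; lia.
Qed.

Lemma psize_prod_exp_XsubC (e : F -> nat) :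
  psize (\prod_c ('X - c%:P) ^+ e c) = (\sum_c e c).+1.
Proof.
suff [] : \prod_c ('X - c%:P) ^+ e c \is monic /\
  psize (\prod_c ('X - c%:P) ^+ e c) = (\sum_c e c).+1 by [].
apply: (big_ind2 (fun (p : {poly F}) n => p \is monic /\ psize p = n.+1)).
- by split; [exact: monic1 | exact: size_poly1].
- move=> p m p' m' [mp sp] [mp' sp']; split; first exact: rpredM.
  by rewrite psizeM ?monic_neq0 // sp sp'; lia.
- move=> c _; split; first by rewrite rpredX // monicXsubC.
  by rewrite /psize size_exp_XsubC.
Qed.

(** Here the character sum becomes a degree. *)
Lemma psize_start_den sg :
  (psize (start_den sg))%:Z = q%:Z + 1 + (-1) ^+ sg * \sum_c qchar f.[c].
Proof.
rewrite psize_prod_exp_XsubC -addn1 PoszD (big_morph Posz PoszD (erefl 0%:Z)).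
rewrite (eq_bigr _ (fun c _ => start_multE sg c)) big_split /= sumr_const -mulr_sumr.
by rewrite natz -/q; ring.
Qed.

(** The start of the sequence: [P_0 = ('X^q, f ^+ h)] and [P_0] plus or minus [('X, 1)], with the
    factors common to numerator and denominator cancelled. *)
Lemma start_neighbours sg :
  neighbours a b (start_num (~~ sg) %/ start_den sg) (start_den (~~ sg)) 'X^q 1
    (start_num sg %/ start_den (~~ sg)) (start_den sg).
Proof.
have den0 s : start_den s != 0 by rewrite -psize_gt0 psize_prod_exp_XsubC.
have dvd1 := start_den_dvd sg; have dvd2 := start_den_dvd (~~ sg); rewrite negbK in dvd2.
have numM : start_num (~~ sg) * start_num sg = qA b 'X^q 1 * qC 'X^q 1.
  by rewrite -start_numM; case: (sg); rewrite //= mulrC.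
have denM : start_den (~~ sg) * start_den sg = qC 'X^q 1.
  by rewrite -start_denM; case: (sg); rewrite //= mulrC.
split=> //.
  apply: (mulIf (mulf_neq0 (den0 (~~ sg)) (den0 sg))); rewrite [in RHS]denM -numM.
  by rewrite -[in RHS](divpK dvd1) -[in RHS](divpK dvd2); ring.
rewrite !divpK // /qB /start_num /half_sum.
have -> : (2 * (-1) ^+ ~~ sg)%:P = - (2 * (-1) ^+ sg)%:P :> {poly F}.
  by rewrite -polyCN; congr _%:P; case: (sg); rewrite /= ?expr1 ?expr0; ring.
ring.
Qed.

Lemma start_bound (sg : bool) (n : nat) :
  0 <= n%:Z ^+ 2 + ((-1) ^+ sg * \sum_c qchar f.[c]) * n%:Z + q%:Z.
Proof.
have den0 s : start_den s != 0 by rewrite -psize_gt0 psize_prod_exp_XsubC.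
have psize1 : psize (1 : {poly F}) = 1%N by exact: size_poly1.
have psizeXq : psize ('X^q : {poly F}) = q.+1 by exact: size_polyXn.
have q2 : (1 < q)%N := finNzRing_gt1 F.
have n2 := two_neq0 F_odd.
have sz s : (psize (start_num s %/ start_den (~~ s)))%:Z =
    q%:Z + 2 - (-1) ^+ (~~ s) * \sum_c qchar f.[c].
  have := psize_start_num s; rewrite -{1}(divpK (start_den_dvd s)).
  have quo0 : start_num s %/ start_den (~~ s) != 0.
    rewrite dvdp_div_eq0 ?start_den_dvd // -psize_gt0 psize_start_num //.
  have := psize_start_den (~~ s); rewrite psizeM //.
  have : (0 < psize (start_den (~~ s)))%N by rewrite psize_gt0.
  move: (psize (start_den _)) (psize (_ %/ _)) => m k.
  by lia.
have nb := start_neighbours sg.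
have swap s : neighbours a b (start_num (~~ s) %/ start_den s) (start_den (~~ s)) 'X^q 1
    (start_num s %/ start_den (~~ s)) (start_den s) ->
  coprimep (start_num s %/ start_den (~~ s)) (start_den s).
  exact: (neighbours_coprime n2 b_neq0 disc_neq0 (coprimep1 _)).
have cop := swap (~~ sg) (start_neighbours _); rewrite negbK in cop.
have szlt : (psize (start_den (~~ sg)) < psize (start_num (~~ sg) %/ start_den sg))%N.
  have := sz (~~ sg); have := psize_start_den (~~ sg); rewrite !negbK.
  have -> : (-1) ^+ sg = - (-1) ^+ (~~ sg) :> int.
    by case: (sg); rewrite /= ?expr1 ?expr0 ?opprK.
  rewrite mulNr opprK.
  move: (psize (start_den _)) (psize (_ %/ _)) => m k.
  by lia.
have sg1 : (-1) ^+ (~~ sg) = - (-1) ^+ sg :> int.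
  by case: (sg); rewrite /= ?expr1 ?expr0 ?opprK.
(* The numerators at [P_0] and its neighbour have degrees [q] and [q + 1 + s], with [s] the signed
   character sum, so the linear coefficient is [s]. *)
have := @neighbours_degree _ a b n2 b_neq0 disc_neq0 _ _ _ _ _ _ q%:Z
  (q%:Z + 1 + (-1) ^+ sg * \sum_c qchar f.[c]) n cop (coprimep1 _) szlt _ nb.
have -> : q%:Z + 1 + (-1) ^+ sg * \sum_c qchar f.[c] - q%:Z - 1 =
  (-1) ^+ sg * \sum_c qchar f.[c] by ring.
apply; first by rewrite psize1 psizeXq ltnS ltnW.
  by rewrite psizeXq -addn1 PoszD.
by rewrite sz sg1 mulNr opprK; ring.
Qed.

Lemma hasse_root0 : (\sum_c qchar (c * (c ^+ 2 + a * c + b))) ^+ 2 <= 4 * #|F|%:Z.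
Proof.
have -> : \sum_c qchar (c * (c ^+ 2 + a * c + b)) = \sum_c qchar f.[c].
  by apply: eq_bigr => c _; rewrite /f hornerM !hornerE.
apply: discriminant_le F_odd _ _ => n.
  by have := start_bound false n; rewrite expr0 mul1r.
by have := start_bound true n; rewrite expr1 mulN1r mulNr.
Qed.

End Hasse.

(** * Character sums over cubics and quartics with distinct rational roots *)

Section CharacterSums.

Variable F : finFieldType.
Hypothesis F_odd : odd #|F|.

(** Translation by [- b1] puts a root at 0; the discriminant of the other factor is
    [(b2 - b3) ^+ 2]. *)
Lemma sum_qchar_cubic (b1 b2 b3 : F) : b1 != b2 -> b1 != b3 -> b2 != b3 ->
  (\sum_x qchar (x + b1) * qchar (x + b2) * qchar (x + b3)) ^+ 2 <= 4 * #|F|%:Z.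
Proof.
move=> n12 n13 n23; rewrite -(sum_translate _ (- b1)).
have := @hasse_root0 F (b2 - b1 + (b3 - b1)) ((b2 - b1) * (b3 - b1)) F_odd.
have n1 : b2 - b1 != 0 by rewrite subr_eq0 eq_sym.
have n2 : b3 - b1 != 0 by rewrite subr_eq0 eq_sym.
have e : (b2 - b1 + (b3 - b1)) ^+ 2 - 4 * ((b2 - b1) * (b3 - b1)) = (b2 - b3) ^+ 2 by ring.
rewrite e mulf_neq0 // expf_neq0 ?[b2 - b3 == 0]subr_eq0 // => /(_ isT isT).
congr (_ ^+ 2 <= _); apply: eq_bigr => x _; rewrite -!(qcharM F_odd); congr qchar; ring.
Qed.

(** The sign in front of the cubic sum in [sum_qchar_invert] is absorbed in [s]. *)
Lemma sum_qchar_quartic (b1 b2 b3 b4 : F) : uniq [:: b1; b2; b3; b4] ->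
  exists2 s : int, s ^+ 2 <= 4 * #|F|%:Z &
  \sum_x qchar (x + b1) * qchar (x + b2) * qchar (x + b3) * qchar (x + b4) = s - 1.
Proof.
rewrite /= !inE !negb_or -!andbA => /and5P[n12 n13 n14 n23 /and3P[n24 n34 _]].
have n1 : b2 - b1 != 0 by rewrite subr_eq0 eq_sym.
have n2 : b3 - b1 != 0 by rewrite subr_eq0 eq_sym.
have n3 : b4 - b1 != 0 by rewrite subr_eq0 eq_sym.
rewrite -(sum_translate _ (- b1)).
under eq_bigr do rewrite addrNK -!addrA ![- b1 + _]addrC.
rewrite sum_qchar_invert //; eexists; last by [].
rewrite !exprMn !qchar_sqr // !mul1r; apply: sum_qchar_cubic.
all: by rewrite (inj_eq invr_inj) (inj_eq (addIr _)).
Qed.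

End CharacterSums.

(** * Moments of a sum of translates *)

Section DistinctSums.

Variables (T : finType) (R : comRingType).
Implicit Types (B : {set T}) (e : T -> R).

Definition dsum2 (V : nmodType) B (g : T -> T -> V) :=
  \sum_(b1 in B) \sum_(b2 in B :\ b1) g b1 b2.
Definition dsum3 (V : nmodType) B (g : T -> T -> T -> V) :=
  \sum_(b1 in B) dsum2 (B :\ b1) (g b1).
Definition dsum4 (V : nmodType) B (g : T -> T -> T -> T -> V) :=
  \sum_(b1 in B) dsum3 (B :\ b1) (g b1).

Definition psum e B k := \sum_(b in B) e b ^+ k.

Lemma sum_setD1 e B b : b \in B -> \sum_(c in B :\ b) e c = \sum_(c in B) e c - e b.
Proof. by move=> bB; rewrite [in RHS](big_setD1 b bB) /= addrAC subrr add0r. Qed.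

Lemma psum_setD1 e B b k : b \in B -> psum e (B :\ b) k = psum e B k - e b ^+ k.
Proof. exact: sum_setD1. Qed.

(** This and the next two lemmas are Newton's identities for [k!] times the [k]-th elementary
    symmetric function, each deduced from the previous one on [B :\ b]. *)
Lemma dsum2_prod e B : dsum2 B (fun b1 b2 => e b1 * e b2) = psum e B 1 ^+ 2 - psum e B 2.
Proof.
transitivity (\sum_(b in B) (psum e B 1 * e b ^+ 1 - e b ^+ 2)).
  apply: eq_bigr => b bB; rewrite -mulr_sumr -[\sum_(_ in _) _]/(psum e (B :\ b) 1).
  by rewrite psum_setD1 //; ring.
by rewrite sumrB -mulr_sumr -!/(psum _ _ _); ring.
Qed.

Lemma dsum3_prod e B : dsum3 B (fun b1 b2 b3 => e b1 * e b2 * e b3) =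
  psum e B 1 ^+ 3 - 3 * psum e B 1 * psum e B 2 + 2 * psum e B 3.
Proof.
transitivity (\sum_(b in B) (e b * dsum2 (B :\ b) (fun b2 b3 => e b2 * e b3))).
  apply: eq_bigr => b bB; rewrite mulr_sumr; apply: eq_bigr => c cB.
  by rewrite mulr_sumr; apply: eq_bigr => d dB; rewrite mulrA.
transitivity (\sum_(b in B) ((psum e B 1 ^+ 2 - psum e B 2) * e b ^+ 1
   - 2 * psum e B 1 * e b ^+ 2 + 2 * e b ^+ 3)).
  by apply: eq_bigr => b bB; rewrite dsum2_prod !psum_setD1 //; ring.
by rewrite big_split sumrB /= -!mulr_sumr -!/(psum _ _ _); ring.
Qed.

Lemma dsum4_prod e B : dsum4 B (fun b1 b2 b3 b4 => e b1 * e b2 * e b3 * e b4) =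
  psum e B 1 ^+ 4 - 6 * psum e B 1 ^+ 2 * psum e B 2 + 3 * psum e B 2 ^+ 2
  + 8 * psum e B 1 * psum e B 3 - 6 * psum e B 4.
Proof.
transitivity (\sum_(b in B) (e b * dsum3 (B :\ b) (fun b2 b3 b4 => e b2 * e b3 * e b4))).
  apply: eq_bigr => b bB; rewrite mulr_sumr; apply: eq_bigr => c cB.
  rewrite mulr_sumr; apply: eq_bigr => d dB; rewrite mulr_sumr.
  by apply: eq_bigr => f fB; rewrite !mulrA.
transitivity (\sum_(b in B) ((psum e B 1 ^+ 3 - 3 * psum e B 1 * psum e B 2 + 2 * psum e B 3) * e b ^+ 1
   + (3 * psum e B 2 - 3 * psum e B 1 ^+ 2) * e b ^+ 2 + 6 * psum e B 1 * e b ^+ 3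
   - 6 * e b ^+ 4)).
  by apply: eq_bigr => b bB; rewrite dsum3_prod !psum_setD1 //; ring.
by rewrite sumrB !big_split /= -!mulr_sumr -!/(psum _ _ _); ring.
Qed.

End DistinctSums.

Section DistinctSumsTheory.

Variable T : finType.
Implicit Types B : {set T}.

Lemma dsum2_exchange (V : nmodType) (I : finType) B (g : I -> T -> T -> V) :
  \sum_i dsum2 B (g i) = dsum2 B (fun b1 b2 => \sum_i g i b1 b2).
Proof.
rewrite /dsum2 exchange_big; apply: eq_bigr => b1 _; exact: exchange_big.
Qed.

Lemma dsum3_exchange (V : nmodType) (I : finType) B (g : I -> T -> T -> T -> V) :
  \sum_i dsum3 B (g i) = dsum3 B (fun b1 b2 b3 => \sum_i g i b1 b2 b3).
Proof.
rewrite /dsum3 exchange_big; apply: eq_bigr => b1 _; exact: dsum2_exchange.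
Qed.

Lemma dsum4_exchange (V : nmodType) (I : finType) B (g : I -> T -> T -> T -> T -> V) :
  \sum_i dsum4 B (g i) = dsum4 B (fun b1 b2 b3 b4 => \sum_i g i b1 b2 b3 b4).
Proof.
rewrite /dsum4 exchange_big; apply: eq_bigr => b1 _; exact: dsum3_exchange.
Qed.

Variable R : numDomainType.

Lemma psum1 B k : psum (fun=> 1 : R) B k = #|B|%:R.
Proof. by rewrite /psum (eq_bigr (fun=> 1)) ?sumr_const // => b _; rewrite expr1n. Qed.

(** The number of ordered pairs of distinct elements is [dsum2_prod] at the constant 1; triples and
    quadruples are counted likewise below. *)
Lemma dsum2_const B (C : R) (g : T -> T -> R) :
  (forall b1 b2, b1 != b2 -> g b1 b2 = C) -> dsum2 B g = C * (#|B|%:R ^+ 2 - #|B|%:R).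
Proof.
move=> gC; transitivity (C * dsum2 B (fun _ _ => 1 * 1 : R)); last first.
  by rewrite (dsum2_prod (fun=> 1)) !psum1.
rewrite mulr_sumr; apply: eq_bigr => b1 _; rewrite mulr_sumr; apply: eq_bigr => b2.
by rewrite !inE eq_sym => /andP[n12 _]; rewrite gC // !mulr1.
Qed.

Lemma dsum3_le B (C : R) (g : T -> T -> T -> R) :
  (forall b1 b2 b3, uniq [:: b1; b2; b3] -> g b1 b2 b3 <= C) ->
  dsum3 B g <= C * (#|B|%:R ^+ 3 - 3 * #|B|%:R ^+ 2 + 2 * #|B|%:R).
Proof.
move=> gC; apply: (@le_trans _ _ (C * dsum3 B (fun _ _ _ => 1 * 1 * 1 : R))); last first.
  by rewrite (dsum3_prod (fun=> 1)) !psum1 expr2 mulrA.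
rewrite mulr_sumr; apply: ler_sum => b1 b1B; rewrite mulr_sumr; apply: ler_sum => b2 b2B.
rewrite mulr_sumr; apply: ler_sum => b3; rewrite !inE in b2B * => /and3P[n32 n31 b3B].
case/andP: b2B => n21 _; rewrite !mulr1 gC //= !inE (eq_sym b1 b2) (eq_sym b1 b3) (eq_sym b2 b3).
by rewrite negb_or n31 n32 n21.
Qed.

Lemma dsum4_le B (C : R) (g : T -> T -> T -> T -> R) :
  (forall b1 b2 b3 b4, uniq [:: b1; b2; b3; b4] -> g b1 b2 b3 b4 <= C) ->
  dsum4 B g <= C * (#|B|%:R ^+ 4 - 6 * #|B|%:R ^+ 3 + 11 * #|B|%:R ^+ 2 - 6 * #|B|%:R).
Proof.
move=> gC; apply: (@le_trans _ _ (C * dsum4 B (fun _ _ _ _ => 1 * 1 * 1 * 1 : R))); last first.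
  by rewrite (dsum4_prod (fun=> 1)) !psum1 le_eqVlt; apply/orP; left; apply/eqP; ring.
rewrite mulr_sumr; apply: ler_sum => b1 b1B; rewrite mulr_sumr; apply: ler_sum => b2 b2B.
rewrite mulr_sumr; apply: ler_sum => b3 b3B; rewrite mulr_sumr; apply: ler_sum => b4.
rewrite !inE in b2B b3B * => /and4P[n43 n42 n41 b4B].
case/and3P: b3B => n32 n31 b3B; case/andP: b2B => n21 _.
rewrite !mulr1 gC //= !inE (eq_sym b1 b2) (eq_sym b1 b3) (eq_sym b1 b4).
rewrite (eq_sym b2 b3) (eq_sym b2 b4) (eq_sym b3 b4) !negb_or.
by rewrite n43 n42 n41 n32 n31 n21.
Qed.

End DistinctSumsTheory.

(** * The weighted fourth moment inequality *)

Section Moments.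

Variables (R : rcfType) (F : finFieldType).
Hypothesis F_odd : odd #|F|.

Definition chi (x : F) : R := (qchar x)%:~R.

Local Notation u := (Num.sqrt (#|F|%:R : R)).

Lemma sqrt_card_sqr : u ^+ 2 = #|F|%:R.
Proof. by rewrite sqr_sqrtr ?ler0n. Qed.

Lemma sum_const_card (c : R) : \sum_(x : F) c = c * u ^+ 2.
Proof. by rewrite sumr_const sqrt_card_sqr mulr_natr. Qed.

Lemma chi0 : chi 0 = 0. Proof. by rewrite /chi qchar0. Qed.

Lemma chi_sqr x : x != 0 -> chi x ^+ 2 = 1.
Proof. by move=> x0; rewrite /chi -rmorphXn /= qchar_sqr. Qed.

Lemma chi_cube x : chi x ^+ 3 = chi x.
Proof.
by have [->|x0] := eqVneq x 0; rewrite ?chi0 ?expr0n // exprS chi_sqr ?mulr1.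
Qed.

Lemma chi_bound x : -1 <= chi x <= 1.
Proof.
have := qchar_bound x; rewrite ler_norml => /andP[h1 h2].
have -> : -1 = (-1)%:~R :> R by rewrite rmorphN1.
by rewrite /chi ler_int lerz1 h1 h2.
Qed.

Lemma sqr_le_card (s : int) : s ^+ 2 <= 4 * #|F|%:Z -> `|s%:~R : R| <= 2 * u.
Proof.
rewrite -(ler_int R) rmorphXn rmorphM /= => hs.
rewrite -(ler_sqr) ?nnegrE ?mulr_ge0 ?sqrtr_ge0 // real_normK ?num_real //.
by rewrite exprMn sqrt_card_sqr; apply: le_trans hs _; rewrite -pmulrn -natrX.
Qed.

Lemma sum_chi : \sum_x chi x = 0.
Proof. by rewrite -rmorph_sum /= (sum_qchar F_odd). Qed.

Lemma sum_chi_pair b c : b != c -> \sum_x chi (x + b) * chi (x + c) = -1.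
Proof.
move=> bc; rewrite (eq_bigr (fun x => (qchar (x + b) * qchar (x + c))%:~R)).
  by rewrite -rmorph_sum /= (sum_qchar_pair F_odd bc).
by move=> x _; rewrite rmorphM.
Qed.

Lemma sum_chi_cubic b1 b2 b3 : uniq [:: b1; b2; b3] ->
  `|\sum_x chi (x + b1) * chi (x + b2) * chi (x + b3)| <= 2 * u.
Proof.
rewrite /= !inE negb_or !andbT -andbA => /and3P[n12 n13 n23].
rewrite (eq_bigr (fun x => (qchar (x + b1) * qchar (x + b2) * qchar (x + b3))%:~R)).
  by rewrite -rmorph_sum; apply/sqr_le_card/(sum_qchar_cubic F_odd).
by move=> x _; rewrite !rmorphM.
Qed.

Lemma sum_chi_quartic b1 b2 b3 b4 : uniq [:: b1; b2; b3; b4] ->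
  \sum_x chi (x + b1) * chi (x + b2) * chi (x + b3) * chi (x + b4) <= 2 * u - 1.
Proof.
move=> ub; have [s s4 es] := sum_qchar_quartic F_odd ub.
rewrite (eq_bigr (fun x =>
  (qchar (x + b1) * qchar (x + b2) * qchar (x + b3) * qchar (x + b4))%:~R)).
  rewrite -rmorph_sum /= es rmorphB rmorph1 lerD2r.
  exact: le_trans (ler_norm _) (sqr_le_card s4).
by move=> x _; rewrite !rmorphM.
Qed.

Definition translate_sum (B : {set F}) (x : F) : R := \sum_(b in B) chi (x + b).

Local Notation p B x := (psum (fun b => chi (x + b)) B).

Lemma psum_chi3 B x : p B x 3 = p B x 1.
Proof. by apply: eq_bigr => b _; rewrite chi_cube expr1. Qed.

Lemma psum_chi4 B x : p B x 4 = p B x 2.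
Proof. by apply: eq_bigr => b _; rewrite exprS chi_cube -expr2. Qed.

Lemma psum_chi1 B x : p B x 1 = translate_sum B x.
Proof. by []. Qed.

(** The correction accounts for the vanishing term [chi 0]. *)
Lemma psum_chi2 B x : p B x 2 = #|B|%:R - (- x \in B)%:R.
Proof.
have E b : b != - x -> chi (x + b) ^+ 2 = 1.
  by move=> bx; rewrite chi_sqr // addrC -[x]opprK subr_eq0.
rewrite /psum; have [xB|xB] := boolP (- x \in B).
  rewrite (big_setD1 _ xB) /= addrN chi0 expr0n add0r (eq_bigr (fun=> 1)).
    by rewrite sumr_const [#|B|](cardsD1 (- x)) xB natrD addrAC subrr add0r.
  by move=> b; rewrite !inE => /andP[/E].
rewrite subr0 (eq_bigr (fun=> 1)) ?sumr_const // => b bB.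
by apply: E; apply: contraNneq xB => <-.
Qed.

Lemma sum_translate_sum B : \sum_x translate_sum B x = 0.
Proof.
rewrite /translate_sum exchange_big big1 // => b _.
by rewrite (sum_translate chi) sum_chi.
Qed.

Local Notation n B := (#|B|%:R : R).

Lemma translate_sum_sqr B x : translate_sum B x ^+ 2 =
  dsum2 B (fun b1 b2 => chi (x + b1) * chi (x + b2)) + n B - (- x \in B)%:R.
Proof.
rewrite (dsum2_prod (fun b => chi (x + b))) psum_chi2 psum_chi1; ring.
Qed.

(* The weight [S ^ 2 (S + 2) ^ 2] is nonnegative, it is large on [A], and its average
   involves character sums of degree at most 4 only. *)
Lemma translate_sum_weight B x :
  let d3 := dsum3 B (fun b1 b2 b3 => chi (x + b1) * chi (x + b2) * chi (x + b3)) in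
  let d4 := dsum4 B
    (fun b1 b2 b3 b4 => chi (x + b1) * chi (x + b2) * chi (x + b3) * chi (x + b4)) in
  let S := translate_sum B x in let d : R := (- x \in B)%:R in
  S ^+ 2 * (S + 2) ^+ 2 = d4 + 4 * d3 + (6 * n B - 4) * S ^+ 2 + (12 * n B - 8) * S
    + (6 * n B - 3 * n B ^+ 2) + d * (6 * n B - 3 - 6 * (S + 1) ^+ 2).
Proof.
move=> d3 d4 S d; rewrite /d4 /d3 (dsum4_prod (fun b => chi (x + b))).
rewrite (dsum3_prod (fun b => chi (x + b))) psum_chi3 psum_chi4 psum_chi2 psum_chi1.
rewrite -/S -/d; have : d ^+ 2 = d by rewrite /d; case: (_ \in _); rewrite ?expr1n ?expr0n.
by move=> dd; ring: dd.
Qed.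

Lemma card_neg_mem (B : {set F}) : \sum_x (- x \in B)%:R = n B.
Proof.
rewrite (reindex_inj oppr_inj) /= (eq_bigr (fun x => if x \in B then 1 else 0)).
  by rewrite -big_mkcond sumr_const.
by move=> x _; rewrite opprK; case: ifP.
Qed.

Lemma card_mul_weight_le (A B : {set F}) :
  (forall a b, a \in A -> b \in B -> chi (a + b) = 1) ->
  #|A|%:R * (n B ^+ 2 * (n B + 2) ^+ 2) <=
  (2 * u - 1) * (n B ^+ 4 - 6 * n B ^+ 3 + 11 * n B ^+ 2 - 6 * n B)
  + 8 * u * (n B ^+ 3 - 3 * n B ^+ 2 + 2 * n B)
  + u ^+ 2 * (3 * n B ^+ 2 + 2 * n B) - 6 * n B ^+ 3 + 10 * n B ^+ 2 - 3 * n B.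
Proof.
move=> AB1; set N := n B; pose S := translate_sum B.
have SA a : a \in A -> S a = N.
  by move=> aA; rewrite /S /translate_sum (eq_bigr (fun=> 1)) ?sumr_const // => b /AB1 ->.
have -> : #|A|%:R * (N ^+ 2 * (N + 2) ^+ 2) = \sum_(a in A) S a ^+ 2 * (S a + 2) ^+ 2.
  by rewrite mulr_natl -sumr_const; apply: eq_bigr => a aA; rewrite SA.
have : \sum_(a in A) S a ^+ 2 * (S a + 2) ^+ 2 <= \sum_a S a ^+ 2 * (S a + 2) ^+ 2.
  rewrite [leRHS](bigID (mem A)) /= lerDl sumr_ge0 // => a _.
  by rewrite mulr_ge0 ?sqr_ge0.
move/le_trans; apply.
pose g3 x b1 b2 b3 := chi (x + b1) * chi (x + b2) * chi (x + b3).
pose g4 x b1 b2 b3 b4 := chi (x + b1) * chi (x + b2) * chi (x + b3) * chi (x + b4).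
pose g2 x b1 b2 := chi (x + b1) * chi (x + b2).
pose d x : R := (- x \in B)%:R.
(* Once [S x ^+ 2] is expanded, the coefficient of [d x] is [1 - 6 (S x + 1)^2], at most 1. *)
have pw x : S x ^+ 2 * (S x + 2) ^+ 2 <= dsum4 B (g4 x) + 4 * dsum3 B (g3 x)
   + (6 * N - 4) * dsum2 B (g2 x) + (12 * N - 8) * S x
   + (6 * N - 3 * N ^+ 2 + (6 * N - 4) * N) + 1 * d x.
  rewrite translate_sum_weight -/(S x) -/(d x) -/N.
  rewrite translate_sum_sqr -/(d x) -/N; have d0 : 0 <= d x by exact: ler0n.
  have := mulr_ge0 d0 (sqr_ge0 (S x + 1)); rewrite -/(g2 x); lra.
apply: le_trans (ler_sum _ (fun x _ => pw x)) _.
rewrite !big_split /= -!mulr_sumr sum_translate_sum card_neg_mem -/N !sum_const_card.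
rewrite (dsum4_exchange B g4) (dsum3_exchange B g3) (dsum2_exchange B g2).
rewrite (@dsum2_const _ _ _ (-1)) -/N; last by move=> b1 b2; exact: sum_chi_pair.
have h3 : dsum3 B (fun b1 b2 b3 => \sum_x g3 x b1 b2 b3) <=
    2 * u * (N ^+ 3 - 3 * N ^+ 2 + 2 * N).
  apply: dsum3_le => b1 b2 b3 ub; exact: le_trans (ler_norm _) (sum_chi_cubic ub).
have h4 : dsum4 B (fun b1 b2 b3 b4 => \sum_x g4 x b1 b2 b3 b4) <=
    (2 * u - 1) * (N ^+ 4 - 6 * N ^+ 3 + 11 * N ^+ 2 - 6 * N).
  by apply: dsum4_le => b1 b2 b3 b4 ub; exact: sum_chi_quartic ub.
move: h3 h4; set E3 := dsum3 _ _; set E4 := dsum4 _ _; rewrite -!(subr_ge0 E3) -(subr_ge0 E4).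
(* The two sides differ exactly by the slack [D4 + 4 * D3]. *)
set D3 := _ - E3; set D4 := _ - E4 => h3 h4; rewrite -subr_ge0.
have D0 : 0 <= D4 + 4 * D3 by rewrite addr_ge0 ?mulr_ge0 ?ler0n.
by apply: le_trans D0 _; rewrite le_eqVlt; apply/orP; left; apply/eqP; rewrite /D3 /D4; ring.
Qed.

End Moments.

(** * Sumsets equal to the set of squares *)

Section RealInequalities.

Variables (R : realFieldType) (m n u : R).

Hypothesis weight_le : m * (n ^+ 2 * (n + 2) ^+ 2) <=
  (2 * u - 1) * (n ^+ 4 - 6 * n ^+ 3 + 11 * n ^+ 2 - 6 * n)
  + 8 * u * (n ^+ 3 - 3 * n ^+ 2 + 2 * n)
  + u ^+ 2 * (3 * n ^+ 2 + 2 * n) - 6 * n ^+ 3 + 10 * n ^+ 2 - 3 * n.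

Lemma lower_of_weight : 3 <= n -> u ^+ 2 <= 2 * (m * n) + 1 -> 2 * u + 1 <= 8 * n.
Proof.
move=> n3 umn; rewrite leNgt; apply/negP => ltu.
(* The claim [u / 4 + 1 / 8 <= n] means [t <= 0]. *)
pose t := u - 4 * n + 1 / 2; have t0 : 0 < t by rewrite /t; lra.
have n0 : 0 < n by lra.
(* With [RHS] the right-hand side of [weight_le], [P] is
   [(u ^+ 2 - 1) * (n + 2) ^+ 2 - 2 * RHS / n], expanded at [u = 4 * n - 1 / 2]. *)
pose P := 77 / 4 * n ^+ 2 - 73 / 2 * n - 6 + t * ((n - 2) * (4 * n ^+ 2 - n + 4))
          + t ^+ 2 * (n * (n - 2)).
have P0 : 0 < P.
  have k0 : 0 <= n - 3 by lra.
  have kk := mulr_ge0 k0 k0.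
  have h1 : 0 < 77 / 4 * n ^+ 2 - 73 / 2 * n - 6 by lra.
  have h2 : 0 < (n - 2) * (4 * n ^+ 2 - n + 4) by apply: mulr_gt0; lra.
  have h3 : 0 < n * (n - 2) by apply: mulr_gt0; lra.
  have := mulr_gt0 t0 h2; have := mulr_gt0 (exprn_gt0 2 t0) h3; rewrite /P; lra.
have : 0 < n * P by exact: mulr_gt0.
have W0 : 0 <= n * (n + 2) ^+ 2 by rewrite mulr_ge0 ?sqr_ge0 // ltW.
have := ler_wpM2r W0 umn; set X := u ^+ 2 * _ => hX.
have := weight_le; set RHS := (X in _ <= X) => wl.
have -> : n * P = X - n * (n + 2) ^+ 2 - 2 * RHS by rewrite /P /t /X /RHS; field.
have e : (2 * (m * n) + 1) * (n * (n + 2) ^+ 2) =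
  2 * (m * (n ^+ 2 * (n + 2) ^+ 2)) + n * (n + 2) ^+ 2 by ring.
rewrite e in hX; move: wl hX; lra.
Qed.

(** The lower bound on [n] confines [u] to the interval from 1 to [4 n - 1/2]. There [n * D], the
    excess of the left-hand side of [weight_le] at [m = 2 u - 1] over the right-hand side, is
    positive. *)
Lemma upper_of_weight : 3 <= n -> 1 <= u -> 2 * u + 1 <= 8 * n -> m < 2 * u - 1.
Proof.
move=> n3 u1 un; rewrite ltNge; apply/negP => mu.
have W0 : 0 <= n ^+ 2 * (n + 2) ^+ 2 by rewrite mulr_ge0 ?sqr_ge0.
have n0 : 0 < n by lra.
(* [D] is concave in [u], and positive at [1] and at [4 * n - 1 / 2]. *)
pose D := - u ^+ 2 * (3 * n + 2) + u * (12 * n ^+ 2 + 10 * n - 4) - 4 * n ^+ 2 - 3 * n - 3.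
have D0 : 0 < D.
  have r0 : 0 <= 4 * n - 1 / 2 - u by lra.
  have s0 : 0 <= u - 1 by lra.
  have c0 : 0 <= 3 * n + 2 by lra.
  have k0 : 0 <= n - 3 by lra.
  have kk := mulr_ge0 k0 k0.
  have e1 : 0 < 8 * n ^+ 2 + 4 * n - 9 by lra.
  have e2 : 0 < 10 * n ^+ 2 - 67 / 4 * n - 3 / 2 by lra.
  have := mulr_ge0 (mulr_ge0 s0 r0) c0.
  have := mulr_ge0 s0 (ltW e2); have := mulr_ge0 r0 (ltW e1).
  rewrite /D; nra.
have nD0 : 0 < n * D by exact: mulr_gt0.
have := ler_wpM2r W0 mu; have := weight_le; set RHS := (X in _ <= X) => wl hX.
have e : n * D = (2 * u - 1) * (n ^+ 2 * (n + 2) ^+ 2) - RHS by rewrite /D /RHS; ring.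
by move: nD0 wl hX; rewrite e; lra.
Qed.

End RealInequalities.

Section Bounds.

Variables (R : rcfType) (F : finFieldType).
Hypothesis F_odd : odd #|F|.

Local Notation u := (Num.sqrt (#|F|%:R : R)).
Local Notation chi := (@chi R F).

Lemma sqrt_card_ge1 : 1 <= u.
Proof.
have u0 : 0 <= u by exact: sqrtr_ge0.
rewrite -(@ler_pXn2r _ 2) ?nnegrE // expr1n sqrt_card_sqr ler1n.
exact: ltnW (finNzRing_gt1 F).
Qed.

Lemma chi_eq1 x : (chi x == 1) = (qchar x == 1).
Proof. by rewrite /chi -[1]/(1%:~R) eqr_int. Qed.

Definition pair_set (b c : F) := [set x | (chi (x + b) == 1) && (chi (x + c) == 1)].

(** The weight [(1 + chi (x + b)) * (1 + chi (x + c))] is nonnegative, equals 4 on the set, and has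
    total [q - 1]. *)
Lemma card_pair_set b c : b != c -> 4 * #|pair_set b c|%:R <= u ^+ 2 - 1.
Proof.
move=> bc.
have -> : u ^+ 2 - 1 = \sum_x (1 + chi (x + b)) * (1 + chi (x + c)).
  rewrite (eq_bigr (fun x => 1 + chi (x + c) + chi (x + b) + chi (x + b) * chi (x + c))).
    rewrite !big_split /= !(sum_translate chi) !(sum_chi _ F_odd) (sum_chi_pair _ F_odd bc).
    by rewrite sum_const_card; ring.
  by move=> x _; ring.
rewrite mulrC mulr_natl -sumr_const [leRHS](bigID (mem (pair_set b c))) /=.
rewrite -[leLHS]addr0 lerD //.
  apply: ler_sum => x; rewrite inE => /andP[/eqP -> /eqP ->].
  by rewrite le_eqVlt; apply/orP; left; apply/eqP; ring.
apply: sumr_ge0 => x _; have /andP[h1 _] := chi_bound R (x + b).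
by have /andP[h2 _] := chi_bound R (x + c); apply: mulr_ge0; lra.
Qed.

Lemma chi_zero_or x : [\/ x = 0, chi x = 1 | chi x = -1].
Proof.
have [->|x0] := eqVneq x 0; first by constructor 1.
have /eqP := @chi_sqr R F _ x0; rewrite sqrf_eq1 => /orP[]/eqP h.
  by constructor 2.
by constructor 3.
Qed.

(** Otherwise the product [g] is at most 4 at each [- b_i] and 0 elsewhere, so its sum is at most
    12. But the sum is at least [u^2 - 2 u - 3], and [u^2 - 2 u - 15 = (u - 5) (u + 3)]. *)
Lemma three_residues (b1 b2 b3 : F) : uniq [:: b1; b2; b3] -> 5 < u ->
  exists x, [/\ chi (x + b1) = 1, chi (x + b2) = 1 & chi (x + b3) = 1].
Proof.
move=> ub u5.
suff: [exists x, [&& chi (x + b1) == 1, chi (x + b2) == 1 & chi (x + b3) == 1]].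
  by case/existsP => x /and3P[/eqP h1 /eqP h2 /eqP h3]; exists x.
apply: contraT => /existsPn none; suff: False by [].
have n12 : b1 != b2 by move: ub; rewrite /= !inE negb_or; case: eqP.
have n13 : b1 != b3 by move: ub; rewrite /= !inE negb_or; case: (b1 =P b3); rewrite ?andbF.
have n23 : b2 != b3 by move: ub; rewrite /= !inE negb_or; case: (b2 =P b3); rewrite ?andbF.
pose g x := (1 + chi (x + b1)) * (1 + chi (x + b2)) * (1 + chi (x + b3)).
have sum_g : u ^+ 2 - 3 - 2 * u <= \sum_x g x.
  rewrite (eq_bigr (fun x => 1 + chi (x + b1) + chi (x + b2) + chi (x + b3)
     + chi (x + b1) * chi (x + b2) + chi (x + b1) * chi (x + b3) + chi (x + b2) * chi (x + b3)
     + chi (x + b1) * chi (x + b2) * chi (x + b3))); last by move=> x _; rewrite /g; ring.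
  rewrite !big_split /= !(sum_translate chi) !(sum_chi _ F_odd) !(sum_chi_pair _ F_odd) //.
  rewrite sum_const_card.
  by have := sum_chi_cubic R F_odd ub; rewrite ler_norml => /andP[]; lra.
have g_le x : g x <= 4 * ((x == - b1)%:R + (x == - b2)%:R + (x == - b3)%:R).
  have bd y : 0 <= 1 + chi y <= 2 by have /andP[] := chi_bound R y; lra.
  have ind (b : bool) : 0 <= (b%:R : R) by exact: ler0n.
  have z (y b : F) : y + b = 0 -> (y == - b)%:R = 1 :> R.
    by move=> /eqP; rewrite addr_eq0 => ->.
  have i1 := ind (x == - b1); have i2 := ind (x == - b2); have i3 := ind (x == - b3).
  have := none x; rewrite /g; have := bd (x + b1); have := bd (x + b2); have := bd (x + b3).
  case: (chi_zero_or (x + b1)) => [e1|->|->]; last 1 first.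
  - by move=> *; rewrite subrr !mul0r; lra.
  - by rewrite e1 chi0 (z _ _ e1) => /andP[? ?] /andP[? ?] _ _; nra.
  case: (chi_zero_or (x + b2)) => [e2|->|->]; last 1 first.
  - by move=> *; rewrite subrr mulr0 mul0r; lra.
  - by rewrite e2 chi0 (z _ _ e2) => /andP[? ?] _ _ _; nra.
  case: (chi_zero_or (x + b3)) => [e3|->|->]; last 1 first.
  - by move=> *; rewrite subrr mulr0; lra.
  - by rewrite e3 chi0 (z _ _ e3) => _ _ _ _; lra.
  by rewrite eqxx.
have sum_ind b : \sum_x (x == - b)%:R = 1 :> R.
  by rewrite (bigD1 (- b)) //= eqxx big1 ?addr0 // => x /negPf ->.
have := ler_sum (index_enum F) (fun x (_ : xpredT x) => g_le x).
rewrite -mulr_sumr !big_split /= !sum_ind => le12.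
by nra.
Qed.

Lemma sumset_residues (A B : {set F}) a b :
  sumset A B = [set x ^+ 2 | x : F & x != 0] -> a \in A -> b \in B -> chi (a + b) = 1.
Proof.
move=> AB aA bB; apply/eqP; rewrite chi_eq1.
have : a + b \in sumset A B by exact: imset2_f.
by rewrite AB (squares_qchar F_odd) inE.
Qed.

Lemma card_residues_ge : u ^+ 2 <= 2 * #|[set x ^+ 2 | x : F & x != 0]|%:R + 1.
Proof.
rewrite sqrt_card_sqr -natrM natr1 ler_nat {1}(card_odd_half F_odd) ltnS -mul2n.
by rewrite leq_pmul2l // card_squares_ge.
Qed.

(* With [B = [set b; c]], three residues [x + b, x + c, x + c + (c - b)] put
   [x] and [x + c - b] in [pair_set b c], so that [x + c] is twice represented. *)
Lemma sumset_pair_sqrt (A : {set F}) (b c : F) : b != c ->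
  sumset A [set b; c] = [set x ^+ 2 | x : F & x != 0] -> u <= 5.
Proof.
move=> bc AB; rewrite leNgt; apply/negP => u5.
have d0 : c - b != 0 by rewrite subr_eq0 eq_sym.
have ub : uniq [:: b; c; c + (c - b)].
  rewrite /= !inE negb_or bc andbT /=; apply/andP; split.
    rewrite -subr_eq0 (_ : b - (c + (c - b)) = - (2 * (c - b))); last by ring.
    by rewrite oppr_eq0 mulf_neq0 // two_neq0.
  by rewrite -subr_eq0 opprD addNKr oppr_eq0.
have [x [xb xc xd]] := three_residues ub u5.
pose P := pair_set b c.
have PA : A \subset P.
  apply/subsetP => a aA; rewrite inE !(sumset_residues AB aA) ?eqxx //.
    by rewrite !inE eqxx orbT.
  by rewrite !inE eqxx.
pose P1 := [set y + b | y in P]; pose P2 := [set y + c | y in P].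
have le : (#|[set x ^+ 2 | x : F & x != 0%R]| <= #|P1 :|: P2|)%N.
  apply/subset_leq_card; rewrite -AB; apply/subsetP => _ /imset2P[a e aA eB ->].
  have aP := subsetP PA a aA; apply/setUP.
  by case/set2P: eB => ->; [left | right]; exact: imset_f.
have : (0 < #|P1 :&: P2|)%N.
  rewrite card_gt0; apply/set0Pn; exists (x + c); rewrite inE; apply/andP; split.
    apply/imsetP; exists (x + (c - b)); last by ring.
    rewrite inE -addrA subrK xc eqxx /= -addrA [c - b + c]addrC xd eqxx.
    by [].
  by apply/imsetP; exists x; rewrite // inE xb xc eqxx.
have := cardsUI P1 P2; rewrite !card_imset; try exact: addIr.
move=> eUI pos.
(* There are at least [(q - 1) / 2] residues, while [2 * #|P|] is at most [(q - 1) / 2]. *)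
have : (#|[set x ^+ 2 | x : F & x != 0%R]| + 1 <= 2 * #|P|)%N by lia.
rewrite -(ler_nat R) natrD natrM => h.
have := card_pair_set bc; have := card_residues_ge; rewrite -/P; lra.
Qed.

(** One summand is bounded below and the other above; exchanging the summands gives the remaining
    two bounds. *)
Lemma sumset_bounds (A B : {set F}) : (2 <= #|B|)%N ->
  sumset A B = [set x ^+ 2 | x : F & x != 0] ->
  1 / 4 * u + 1 / 8 <= #|B|%:R /\ #|A|%:R < 2 * u - 1.
Proof.
move=> B2 AB; have u1 := sqrt_card_ge1.
have res a b : a \in A -> b \in B -> chi (a + b) = 1 by exact: sumset_residues.
have le_card : u ^+ 2 <= 2 * (#|A|%:R * #|B|%:R) + 1.
  apply: le_trans card_residues_ge _; rewrite lerD2r ler_pM2l ?ltr0n // -natrM ler_nat -AB.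
  rewrite -cardsX /sumset (_ : [set a + b | a in A, b in B] = [set x.1 + x.2 | x in setX A B]).
    exact: leq_imset_card.
  apply/setP => x; apply/imset2P/imsetP => [[a b aA bB ->]|[[a b]]].
    by exists (a, b); rewrite // inE aA.
  by rewrite inE => /andP[aA bB] ->; exists a b.
have := B2; rewrite leq_eqVlt => /orP[B2'|B3].
  have /cards2P[b [c [bc eB]]] : #|B| == 2%N by rewrite eq_sym.
  rewrite eB in AB; have u5 := sumset_pair_sqrt bc AB.
  (* [u <= 5] gives [u / 4 + 1 / 8 <= 11 / 8 < 2]. *)
  rewrite -(eqP B2'); split; first lra.
  (* The bound [(u^2 - 1) / 4] so obtained is below [2 u - 1] for [u] between 1 and 5. *)
  have AP : (#|A| <= #|pair_set b c|)%N.
    apply/subset_leq_card/subsetP => a aA; rewrite inE !res ?eqxx // eB !inE eqxx ?orbT //.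
  rewrite -(ler_nat R) in AP; have := card_pair_set bc.
  by nra.
have B3' : 3 <= #|B|%:R :> R by rewrite ler_nat.
have wt := card_mul_weight_le F_odd res.
have low := lower_of_weight wt B3' le_card.
by split; [lra | exact: upper_of_weight wt B3' u1 low].
Qed.

End Bounds.

Lemma sumsetC (G : finZmodType) (A B : {set G}) : sumset A B = sumset B A.
Proof.
by apply/setP => x; apply/imset2P/imset2P => -[a b aA bB ->]; exists b a => //; rewrite addrC.
Qed.

Theorem theorem1p1 (R : rcfType) (p : nat) (p_prime : prime p) (p_odd : odd p)
    (A B : {set 'F_p}) (cardA : (2 <= #|A|)%N) (cardB : (2 <= #|B|)%N)
    (sumAB : sumset A B = quadres p) :
  (1 / 4 * Num.sqrt (p%:R : R) + 1 / 8 <= #|A|%:R /\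
     #|A|%:R < 2 * Num.sqrt (p%:R : R) - 1) /\
  (1 / 4 * Num.sqrt (p%:R : R) + 1 / 8 <= #|B|%:R /\
     #|B|%:R < 2 * Num.sqrt (p%:R : R) - 1).
Proof.
have F_odd : odd #|'F_p| by rewrite card_Fp.
have sumBA : sumset B A = quadres p by rewrite sumsetC.
have := sumset_bounds R F_odd cardB sumAB; have := sumset_bounds R F_odd cardA sumBA.
by rewrite card_Fp // => -[-> ->] [-> ->].
Qed.
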